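(* For every positive even integer $n$, there exists a configuration of $n$ points whose underlying graph (which has $n$ vertices) contains a non-self-intersecting path (no repeated vertices) through $n-1$ vertices.
   Context: A configuration of $n$ points ($n$ even) is a set of $n$ points in $\mathbb{R}^2$ in general position (no three collinear). A halving line of the configuration is a line through two of the points such that exactly $(n-2)/2$ of the remaining $n-2$ points lie on each side of it. The underlying graph of the configuration is the graph whose vertices are the $n$ points, two vertices being adjacent if and only if the line through the corresponding two points is a halving line. The path need not be an induced subgraph. *)

(* Defs.v *)
From mathcomp Require Import all_boot all_order all_algebra.
From mathcomp Require Import reals.

Set Implicit Arguments.
Unset Strict Implicit.
Unset Printing Implicit Defensive.

Import Order.TTheory GRing.Theory Num.Theory.

Local Open Scope ring_scope.

(* Two-point form of the line through p and q, as the determinant of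
   (q - p, r - p), i.e. twice the signed area of the triangle pqr. For p != q,
   the line through p and q is the zero set in r, and its two sides are the
   open half-planes where the form is positive and negative. *)
Definition line_form (R : realType) (p q r : R * R) : R :=
  (q.1 - p.1) * (r.2 - p.2) - (q.2 - p.2) * (r.1 - p.1).

Definition collinear (R : realType) (p q r : R * R) : bool :=
  line_form p q r == 0.

(* A set of n points of the plane is given by an injective labelling. *)
Definition configuration (R : realType) (n : nat) (P : 'I_n -> R * R) : Prop :=
  injective P /\
  forall i j k : 'I_n, i != j -> i != k -> j != k ->
    ~~ collinear (P i) (P j) (P k).

Definition halving_line (R : realType) (n : nat) (P : 'I_n -> R * R)
    (i j : 'I_n) : bool :=
  [&& i != j,
      #|[set k : 'I_n | [&& k != i, k != j & 0 < line_form (P i) (P j) (P k)]]|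
        == ((n - 2) %/ 2)%N
    & #|[set k : 'I_n | [&& k != i, k != j & line_form (P i) (P j) (P k) < 0]]|
        == ((n - 2) %/ 2)%N].

Definition underlying_graph (R : realType) (n : nat) (P : 'I_n -> R * R) :
    rel 'I_n :=
  fun i j => halving_line P i j.

(* Main.v *)
Require Import Defs.
From mathcomp Require Import all_boot all_order all_algebra.
From mathcomp Require Import reals.
From mathcomp Require Import ring lra.

Set Implicit Arguments.
Unset Strict Implicit.
Unset Printing Implicit Defensive.

Import Order.TTheory GRing.Theory Num.Theory.

Local Open Scope ring_scope.

(** The proof grows a configuration by two points at a time. Let the path be
    x, a, ..., b, y with all its edges halving, and suppose that every inner
    edge (all but xa and by) lies on a line separating x from y. Put a new
    point T very close to x, almost on the line xa but beyond x and on the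
    side of xa away from y; symmetrically put B very close to y, almost on the
    line by, beyond y and on the side of by away from x. Then

    - each inner edge stays halving, because T and B fall on different sides,
      just as x and y do;
    - xa stays halving, because T and B lie on different sides of it by the
      choice of T, and likewise by;
    - Tx is halving: the line is a small rotation of xa about x, hence splits
      the old points other than a as xa does, and its slight tilt leaves a
      and B on opposite sides; likewise By.

    So T, x, a, ..., b, y, B is a halving path with two more vertices, whose
    inner edges (the old ones, including xa and by) all separate T from B:
    the hypothesis is restored ([extensible_path_grow]). The induction starts
    from a triangle with a point inside, where x, a, y are two corners joined
    through the inner point ([extensible_path_star]); the third corner is the
    one vertex that the path never visits.

    Halving is handled as the vanishing of the sum of the orientation signs
    [Num.sg (line_form p q r)] over all points r. Points on the line itself
    contribute 0, so the sum ranges over the whole configuration, and adding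
    a point just adds a term. A configuration is a duplicate-free sequence of
    points until [halving_line_nth] translates back to labelled points. *)

(** * Orientation signs and general position *)

Section Side.

Variable R : realType.
Implicit Types (p q r v a c : R * R) (S : seq (R * R)).

Definition side p q r : R := Num.sg (line_form p q r).

Lemma line_formC p q r : line_form q p r = - line_form p q r.
Proof. by rewrite /line_form; ring. Qed.

Lemma line_form_cycle p q r : line_form q r p = line_form p q r.
Proof. by rewrite /line_form; ring. Qed.

Lemma line_formpp p r : line_form p p r = 0.
Proof. by rewrite /line_form; ring. Qed.

Lemma line_formpqp p q : line_form p q p = 0.
Proof. by rewrite line_form_cycle line_formpp. Qed.

Lemma line_formpqq p q : line_form p q q = 0.
Proof. by rewrite -line_form_cycle line_formpp. Qed.

Lemma sideC p q r : side q p r = - side p q r.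
Proof. by rewrite /side line_formC sgrN. Qed.

Lemma side_swap p q r : side p q r = - side p r q.
Proof. by rewrite -sideC /side line_form_cycle. Qed.

Lemma sidepp p r : side p p r = 0.
Proof. by rewrite /side line_formpp sgr0. Qed.

Lemma sidepqp p q : side p q p = 0.
Proof. by rewrite /side line_formpqp sgr0. Qed.

Lemma sidepqq p q : side p q q = 0.
Proof. by rewrite /side line_formpqq sgr0. Qed.

Definition imbalance S p q : R := \sum_(r <- S) side p q r.

Lemma imbalance_cons r S p q :
  imbalance (r :: S) p q = side p q r + imbalance S p q.
Proof. by rewrite /imbalance big_cons. Qed.

Lemma imbalanceC S p q : imbalance S q p = - imbalance S p q.
Proof. by rewrite /imbalance -sumrN; apply: eq_bigr => r _; rewrite sideC. Qed.

Definition general_position S : Prop :=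
  forall p q r, p \in S -> q \in S -> r \in S ->
    p != q -> p != r -> q != r -> line_form p q r != 0.

Lemma general_position_cons r S :
  general_position S ->
  (forall p q, p \in S -> q \in S -> p != q -> line_form p q r != 0) ->
  general_position (r :: S).
Proof.
move=> gS gr p q s; rewrite !inE.
move=> /predU1P[->|pS] /predU1P[->|qS] /predU1P[->|sS] //; rewrite ?eqxx //.
- by move=> _ _ qs; rewrite -line_form_cycle gr.
- by move=> _ ps _; rewrite line_form_cycle gr // eq_sym.
- by move=> pq _ _; apply: gr.
- exact: gS.
Qed.

(** * Placing a point next to a given one *)

Definition for_small (P : R -> Prop) : Prop :=
  exists2 e, 0 < e & forall t, 0 < t < e -> P t.

Lemma for_small_all S (P : R * R -> R -> Prop) :
  (forall p, p \in S -> for_small (P p)) ->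
  for_small (fun t => forall p, p \in S -> P p t).
Proof.
elim: S => [_|p S IH H]; first by exists 1.
have [|e e0 He] := IH; first by move=> q qS; apply: H; rewrite inE qS orbT.
have [|d d0 Hd] := H p; first by rewrite inE eqxx.
exists (Num.min e d) => [|t]; first by rewrite lt_min e0.
rewrite lt_min => /and3P[t0 te td] q.
rewrite inE => /predU1P[->|qS]; first by apply: Hd; rewrite t0.
by apply: He => //; rewrite t0.
Qed.

(** The signs in question are those of quadratic polynomials in the
    displacement parameter t, and a nonzero constant term dominates. *)
Lemma for_small_sg (c0 c1 c2 : R) : c0 != 0 ->
  for_small (fun t => Num.sg (c0 + t * c1 + t ^+ 2 * c2) = Num.sg c0).
Proof.
move=> c0n0; pose K := `|c1| + `|c2| + 1.
have K0 : 0 < K by rewrite ltr_wpDl // addr_ge0.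
exists (Num.min 1 (`|c0| / K)) => [|t].
  by rewrite lt_min ltr01 divr_gt0 // normr_gt0.
rewrite lt_min ltr_pdivlMr // => /and3P[t0 t1 tK].
have small : `|t * c1 + t ^+ 2 * c2| < `|c0|.
  apply: le_lt_trans tK; apply: le_trans (ler_normD _ _) _.
  rewrite !normrM (gtr0_norm t0) /K.
  (* This product is what makes t^2 |c2| <= t |c2|. *)
  have : 0 <= t * (1 - t) * `|c2| by rewrite !mulr_ge0 ?subr_ge0 // ltW.
  by lra.
rewrite -addrA; move: small; set d := _ + _ * _.
case: (ltgtP c0 0) c0n0 => // c00 _.
  rewrite (ltr0_norm c00) ltr_norml => /andP[_ d1].
  by rewrite !ltr0_sg //; lra.
rewrite (gtr0_norm c00) ltr_norml => /andP[d1 _].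
by rewrite !gtr0_sg //; lra.
Qed.

(** Describes a point T infinitesimally close to v, displaced from it along
    the ray from a through v by a first-order amount, and away from c by a
    second-order amount. Lines through two other points of S cannot tell T
    from v; the line vT is va, up to direction and a tilt too small to be
    noticed by any point of S except a; and the line va separates T from c. *)
Definition shadows S v a c T : Prop :=
  [/\ forall p q, p \in S -> q \in S -> p != v -> q != v ->
        side p q T = side p q v,
      forall p, p \in S -> p != a -> side v p T = side v a p
    & side v a T = - side v a c].

(** The parabola v + t (v - a) + t^2 (v - c) leaves v along the line av and
    bends away from c, so its points with small t > 0 have all the required
    sides. *)
Lemma shadow_exists S v a c :
  general_position S -> v \in S -> a \in S -> a != v ->
  exists T, shadows S v a c T.
Proof.
move=> gS vS aS av.
pose T t : R * R := (v.1 + t * (v.1 - a.1) + t ^+ 2 * (v.1 - c.1),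
                     v.2 + t * (v.2 - a.2) + t ^+ 2 * (v.2 - c.2)).
have lfT p q t : line_form p q (T t) = line_form p q v
    + t * (line_form p q v - line_form p q a)
    + t ^+ 2 * (line_form p q v - line_form p q c).
  by rewrite /line_form /T /=; ring.
have far : for_small (fun t => forall p, p \in S -> forall q, q \in S ->
    p != v -> q != v -> side p q (T t) = side p q v).
  apply: for_small_all => p pS; apply: for_small_all => q qS.
  have [->|pq] := eqVneq p q; first by exists 1 => // t _; rewrite !sidepp.
  have [->|pv] := eqVneq p v; first by exists 1.
  have [->|qv] := eqVneq q v; first by exists 1.
  have [e e0 He] := for_small_sg (line_form p q v - line_form p q a)
     (line_form p q v - line_form p q c) (gS _ _ _ pS qS vS pq pv qv).
  by exists e => // t /He sgT _ _; rewrite /side lfT.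
have through : for_small (fun t => forall p, p \in S -> p != a ->
    side v p (T t) = side v a p).
  apply: for_small_all => p pS.
  have [->|pv] := eqVneq p v.
    by exists 1 => // t _ _; rewrite sidepp sidepqp.
  have [->|pa] := eqVneq p a; first by exists 1.
  have nz : line_form v a p != 0 by apply: gS; rewrite // eq_sym.
  have [e e0 He] := for_small_sg (- line_form v p c) 0 nz.
  exists e => // t te _; have := He t te.
  move: te => /andP[t0 _]; rewrite /side => <-.
  (* The constant term vanishes for lines through v: the factor t is taken
     out, and the first-order term decides. *)
  suff -> : line_form v p (T t)
      = t * (line_form v a p + t * - line_form v p c + t ^+ 2 * 0).
    by rewrite sgrM gtr0_sg // mul1r.
  by rewrite /line_form /T /=; ring.
case: far => e e0 He; case: through => d d0 Hd.
pose t := Num.min e d / 2.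
have m0 : 0 < Num.min e d by rewrite lt_min e0.
have tm : t < Num.min e d by rewrite /t; lra.
have t0 : 0 < t by rewrite /t; lra.
move: tm; rewrite lt_min => /andP[te td].
exists (T t); split.
- by move=> p q pS qS; apply: He; rewrite ?t0.
- by apply: Hd; rewrite t0.
- rewrite /side; suff -> : line_form v a (T t) = t ^+ 2 * - line_form v a c.
    by rewrite sgrM sgrN gtr0_sg ?mul1r // exprn_gt0.
  by rewrite /line_form /T /=; ring.
Qed.

Section Shadow.

Variables (S : seq (R * R)) (v a c T : R * R).
Hypotheses (gS : general_position S) (vS : v \in S) (aS : a \in S)
  (cS : c \in S) (av : a != v) (cv : c != v) (ca : c != a)
  (sT : shadows S v a c T).

Lemma shadow_side p q : p \in S -> q \in S -> p != v -> q != v ->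
  side p q T = side p q v.
Proof. by case: sT => + _ _; apply. Qed.

Lemma shadow_side_through p : p \in S -> p != a -> side v p T = side v a p.
Proof. by case: sT => _ + _; apply. Qed.

Lemma shadow_side_axis : side v a T = - side v a c.
Proof. by case: sT. Qed.

(** Each sign that [shadows] prescribes is, up to sign, the orientation of a
    triple of distinct points of S, hence nonzero. The point c provides it for
    the line va. *)
Lemma shadow_line_form p q : p \in S -> q \in S -> p != q ->
  line_form p q T != 0.
Proof.
have vq q' : q' \in S -> q' != v -> line_form v q' T != 0.
  move=> qS qv; rewrite -sgr_eq0.
  have [->|qa] := eqVneq q' a.
    rewrite -/(side v a T) shadow_side_axis oppr_eq0 sgr_eq0.
    by apply: gS; rewrite // eq_sym.
  rewrite -/(side v q' T) shadow_side_through // sgr_eq0.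
  by apply: gS; rewrite // eq_sym.
move=> pS qS; have [->|pv] := eqVneq p v.
  by rewrite eq_sym; apply: vq.
have [->|qv] := eqVneq q v => pq.
  by rewrite line_formC oppr_eq0 vq.
rewrite -sgr_eq0 -/(side p q T) shadow_side // sgr_eq0.
exact: gS.
Qed.

(** If T were in S, it would lie on the line joining it to a (or to c, in case
    it is a itself). *)
Lemma shadow_notin : T \notin S.
Proof.
apply/negP => TS.
have [eTa|Ta] := eqVneq T a.
  have := shadow_line_form TS cS.
  by rewrite eTa line_formpqp eqxx eq_sym => /(_ ca).
by have := shadow_line_form TS aS Ta; rewrite line_formpqp eqxx.
Qed.

Lemma shadow_general_position : general_position (T :: S).
Proof. exact: general_position_cons gS shadow_line_form. Qed.

(** The line vT sees the points other than a with the orientation opposite to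
    that of va; only a, which has left the line, contributes a new term. *)
Lemma shadow_imbalance : uniq S ->
  imbalance S v T = side v a c - imbalance S v a.
Proof.
move=> uS; rewrite /imbalance !(big_rem a aS) /= sidepqq add0r -sumrN.
rewrite (side_swap v T a) shadow_side_axis opprK; congr (_ + _).
rewrite big_seq [RHS]big_seq; apply: eq_bigr => r.
rewrite mem_rem_uniq // inE => /andP[ra rS].
by rewrite side_swap shadow_side_through.
Qed.

End Shadow.

(** * Growing the path by two vertices *)

(** The path x, a, w, y, in which the interior [a :: w] is kept nonempty so
    that the two end edges are distinct. The sum condition in [ep_inner] says
    that an inner edge separates x from y; the end edges are exempt from it,
    as they pass through x or y themselves. The size equation leaves
    exactly one point of S off the path. *)
Record extensible_path S x a (w : seq (R * R)) y : Prop := ExtensiblePath {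
  ep_general : general_position S;
  ep_uniqS : uniq S;
  ep_uniq : uniq (x :: rcons (a :: w) y);
  ep_sub : {subset x :: rcons (a :: w) y <= S};
  ep_size : size S = (size w).+4;
  ep_first : imbalance S x a = 0;
  ep_last : imbalance S (last a w) y = 0;
  ep_inner : path (fun p q => (imbalance S p q == 0)
                         && (side p q x + side p q y == 0)) a w }.

Lemma extensible_path_grow S x a w y : extensible_path S x a w y ->
  exists T B, extensible_path (B :: T :: S) T x (rcons (a :: w) y) B.
Proof.
case=> gS uS uP sub szS first_bal last_bal inner.
pose b := last a w.
have b_in : b \in a :: w by apply: mem_last.
have inP r : r \in a :: w -> [/\ r \in S, r != x & r != y].
  move: uP; rewrite cons_uniq rcons_uniq mem_rcons inE negb_or.
  move=> /and3P[/andP[xy xw] yw _] rw; split.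
  - by apply: sub; rewrite inE mem_rcons inE rw !orbT.
  - by apply: contraNneq xw => <-.
  - by apply: contraNneq yw => <-.
have xS : x \in S by apply: sub; rewrite inE eqxx.
have yS : y \in S by apply: sub; rewrite inE mem_rcons inE eqxx orbT.
have xy : x != y.
  by move: uP; rewrite cons_uniq mem_rcons inE negb_or => /andP[/andP[]].
have yx : y != x by rewrite eq_sym.
have [aS ax ay] := inP a (mem_head _ _).
have [bS bx b_y] := inP b b_in.
have ya : y != a by rewrite eq_sym.
have xb : x != b by rewrite eq_sym.
have [T sT] := shadow_exists y gS xS aS ax.
have gTS := shadow_general_position gS xS aS yS ax yx ya sT.
have TS := shadow_notin gS xS aS yS ax yx ya sT.
have sS r : r \in S -> r \in T :: S by rewrite inE orbC => ->.
have TT : T \in T :: S by rewrite mem_head.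
have [B sB] := shadow_exists x gTS (sS _ yS) (sS _ bS) b_y.
have gBTS :=
  shadow_general_position gTS (sS _ yS) (sS _ bS) (sS _ xS) b_y xy xb sB.
have BTS := shadow_notin gTS (sS _ yS) (sS _ bS) (sS _ xS) b_y xy xb sB.
have uTS : uniq (T :: S) by rewrite /= TS.
have Ty : T != y by apply: contraNneq TS => ->.
have imb p q : imbalance (B :: T :: S) p q
    = side p q B + (side p q T + imbalance S p q).
  by rewrite !imbalance_cons.
(* B behaves like y with respect to xa, while T was put opposite to y, so
   the two cancel on xa; the same holds for by with x, T, B. *)
have xaB : side x a B = side x a y by apply: (shadow_side sB); rewrite ?sS.
have xaT : side x a T = - side x a y := shadow_side_axis sT.
have ybB : side y b B = - side y b x := shadow_side_axis sB.
have ybT : side y b T = side y b x by apply: (shadow_side sT).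
have yb_bal : imbalance S y b = 0 by rewrite imbalanceC last_bal oppr0.
exists T, B; split.
- exact: gBTS.
- by rewrite /= BTS.
- have PS r : r \in x :: rcons (a :: w) y -> r \in S by apply: sub.
  have TP : T \notin x :: rcons (a :: w) y by apply: contra TS; apply: PS.
  have BP : B \notin x :: rcons (a :: w) y.
    by apply: contra BTS => /PS; apply: sS.
  rewrite cons_uniq rcons_uniq uP BP mem_rcons inE negb_or TP.
  by rewrite !andbT; apply: contraNneq BTS => <-.
- move=> r; rewrite inE mem_rcons inE.
  by case/or3P => [/eqP->|/eqP->|/sub rS]; rewrite !inE ?eqxx ?rS ?orbT.
- by rewrite /= szS size_rcons.
- rewrite imbalanceC imb sidepqq add0r.
  rewrite (shadow_imbalance aS sT uS) first_bal subr0.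
  rewrite (shadow_side sB) ?(sS _ xS) // side_swap.
  by rewrite (shadow_side_through sT) // addNr oppr0.
- rewrite last_rcons imbalance_cons sidepqq add0r.
  rewrite (shadow_imbalance (sS _ bS) sB uTS) imbalance_cons ybT yb_bal.
  by rewrite addr0 subrr.
- rewrite /= rcons_path; apply/and3P; split.
  + by rewrite imb xaB xaT first_bal addr0 subrr eqxx addrC subrr eqxx.
  + apply: (sub_in_path (P := mem (a :: w))) inner; last exact/allP.
    move=> p q /inP[pS px py] /inP[qS qx qy] /andP[/eqP bal /eqP sep].
    rewrite imb (shadow_side sB) ?sS // (shadow_side sT) //.
    by rewrite bal addr0 addrC sep eqxx.
  + rewrite -/b !(sideC y b) imb !(sideC y b) last_bal ybB ybT.
    by rewrite opprK addr0 subrr addNr eqxx.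
Qed.

Lemma extensible_path_star : exists S x a y, extensible_path S x a [::] y.
Proof.
pose a : R * R := (0, 0); pose x : R * R := (1, 0).
pose y : R * R := (0, 1); pose z : R * R := (-1, -1).
exists [:: x; a; y; z], x, a, y.
have xa : x != a by apply/eqP => -[*]; lra.
have xy : x != y by apply/eqP => -[*]; lra.
have xz : x != z by apply/eqP => -[*]; lra.
have ay : a != y by apply/eqP => -[*]; lra.
have az : a != z by apply/eqP => -[*]; lra.
have yz : y != z by apply/eqP => -[*]; lra.
split=> //.
- do !apply: general_position_cons => //; move=> p q; rewrite !inE.
  + by move=> /eqP-> /eqP->; rewrite eqxx.
  + move=> /pred2P[]-> /pred2P[]->; rewrite ?eqxx // => _;
    by apply/eqP; rewrite /line_form /=; lra.
  + move=> /or3P[]/eqP-> /or3P[]/eqP->; rewrite ?eqxx // => _;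
    by apply/eqP; rewrite /line_form /=; lra.
- by rewrite /= !inE !negb_or xa xy xz ay az yz.
- by rewrite /= !inE !negb_or xa xy ay.
- by move=> r; rewrite !inE => /or3P[]->; rewrite ?orbT.
- rewrite !imbalance_cons /imbalance big_nil sidepqp sidepqq /side.
  have -> : line_form x a y = -1 by rewrite /line_form /=; ring.
  have -> : line_form x a z = 1 by rewrite /line_form /=; ring.
  by rewrite sgrN1 sgr1; ring.
- rewrite !imbalance_cons /imbalance big_nil /= sidepqp sidepqq /side.
  have -> : line_form a y x = -1 by rewrite /line_form /=; ring.
  have -> : line_form a y z = 1 by rewrite /line_form /=; ring.
  by rewrite sgrN1 sgr1; ring.
Qed.

Lemma extensible_path_exists m : exists S x a w y,
  extensible_path S x a w y /\ size w = m.*2.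
Proof.
elim: m => [|m [S [x [a [w [y [ext szw]]]]]]].
  have [S [x [a [y ext]]]] := extensible_path_star.
  by exists S, x, a, [::], y.
have [T [B ext']] := extensible_path_grow ext.
exists (B :: T :: S), T, x, (rcons (a :: w) y), B; split=> //.
by rewrite size_rcons /= szw doubleS.
Qed.

(** * Back to labelled points *)

Lemma balanced_path S x a w y : extensible_path S x a w y ->
  path (fun p q => imbalance S p q == 0) x (rcons (a :: w) y).
Proof.
case=> _ _ _ _ _ first_bal last_bal inner.
rewrite rcons_path /= first_bal last_bal eqxx /= andbT.
by apply: sub_path inner => p q /andP[].
Qed.

(** A vanishing sum of signs only says that both sides hold equally many
    points; general position makes the two sides exhaust all points but the
    two on the line, which fixes their common size. *)
Lemma halving_line_nth S : general_position S -> uniq S -> forall n,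
  size S = n ->
  let P (i : 'I_n) := nth (0, 0) S i in forall i j : 'I_n,
  i != j -> imbalance S (P i) (P j) = 0 -> halving_line P i j.
Proof.
move=> gS uS n szS P i j ij.
have PS k : P k \in S by rewrite mem_nth // szS.
have Pinj : injective P.
  by move=> k l /eqP; rewrite nth_uniq ?szS // => /eqP /val_inj.
rewrite /imbalance (big_nth (0, 0)) szS big_mkord -/P => bal.
rewrite /halving_line ij /=.
set A := [set k | _]; set B := [set k | _].
have sgE k : side (P i) (P j) (P k) = (k \in A)%:R - (k \in B)%:R.
  rewrite /A /B !inE.
  have [->|ki] := eqVneq k i; first by rewrite sidepqp subrr.
  have [->|kj] := eqVneq k j; first by rewrite sidepqq subrr.
  rewrite /side /=; case: (ltgtP 0 (line_form _ _ _)) => [l0|l0|<-].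
  - by rewrite gtr0_sg // subr0.
  - by rewrite ltr0_sg // sub0r.
  - by rewrite sgr0 subrr.
have eqAB : #|A| = #|B|.
  apply/eqP; rewrite -(eqr_nat R) -subr_eq0 -!sum1_card !natr_sum.
  rewrite !(big_mkcond (fun k => k \in _)) /= -sumrB -[X in _ == X]bal.
  by apply/eqP; apply: eq_bigr => k _; rewrite sgE; do 2!case: (k \in _).
have AB0 : A :&: B = set0.
  apply/setP => k; rewrite !inE.
  apply/negP => /andP[/and3P[_ _ pos_k] /and3P[_ _]].
  by rewrite ltNge (ltW pos_k).
have ABU : A :|: B = ~: [set i; j].
  apply/setP => k; rewrite !inE negb_or.
  have [//|ki] := eqVneq k i; have [//|kj] := eqVneq k j.
  rewrite /= orbC -neq_lt; apply: gS; rewrite // (inj_eq Pinj) //.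
  - by rewrite eq_sym.
  - by rewrite eq_sym.
have : (#|A| + #|B|)%N = (n - 2)%N.
  by rewrite -cardsUI AB0 cards0 addn0 ABU cardsCs setCK card_ord cards2 ij.
by rewrite -eqAB addnn => <-; rewrite -muln2 mulnK // eqxx.
Qed.

End Side.

Theorem lemma5p5 (R : realType) (n : nat) (n_gt0 : (0 < n)%N)
    (n_even : ~~ odd n) :
  exists P : 'I_n -> R * R,
    configuration P /\
    exists (x : 'I_n) (s : seq 'I_n),
      [/\ path (underlying_graph P) x s, uniq (x :: s)
        & size (x :: s) = (n - 1)%N].
Proof.
have [n4|n2] := leqP 4 n; last first.
  have {n_gt0 n_even n2} -> : n = 2%N.
    by case: n n2 n_gt0 n_even => [|[|[|[|]]]].
  (* Two points: the path is a single vertex. *)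
  exists (fun i => ((i : nat)%:R, 0)); split; last by exists ord0, [::].
  split=> [i j [] /eqP|i j k]; first by rewrite eqr_nat => /eqP /val_inj.
  by case: i => [[|[|]]] // ?; case: j => [[|[|]]] // ?; case: k => [[|[|]]].
have [S [x [a [w [y [ext szw]]]]]] := extensible_path_exists R (n./2 - 2).
have szS : size S = n.
  by rewrite (ep_size ext) szw doubleB even_halfK // -addn4 subnK.
pose P (i : 'I_n) := nth (0, 0) S i.
have Pinj : injective P.
  move=> k l /eqP; rewrite nth_uniq ?szS ?(ep_uniqS ext) //.
  by move=> /eqP /val_inj.
have PS k : P k \in S by rewrite mem_nth // szS.
have [s _ sE] : exists2 s, all (mem (enum 'I_n)) s
    & x :: rcons (a :: w) y = map P s.
  apply/subset_mapP => r /(ep_sub ext) rS.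
  have lt_r : (index r S < n)%N by rewrite -szS index_mem.
  apply/mapP; exists (Ordinal lt_r); first by rewrite mem_enum.
  by rewrite /P nth_index.
exists P; split.
  split=> // i j k ij ik jk; apply: (ep_general ext); rewrite ?(inj_eq Pinj) //.
have szs : size s = (n - 1)%N.
  rewrite -(size_map P) -sE -szS (ep_size ext) /= size_rcons /=.
  by rewrite subn1.
have us : uniq s by apply: (@map_uniq _ _ P); rewrite -sE (ep_uniq ext).
case: s sE szs us => // i s [xE]; rewrite -rcons_cons => sE szs us.
exists i, s; split=> //.
have := balanced_path ext; rewrite sE xE path_map => bal.
have : path (fun k l => (k != l) && (imbalance S (P k) (P l) == 0)) i s.
  elim: s i us bal {xE sE szs} => //= j s IH i /andP[].
  rewrite inE negb_or => /andP[ij _] us /andP[-> bal].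
  by rewrite ij IH.
apply: sub_path => k l /andP[kl /eqP].
by apply: halving_line_nth; [exact: ep_general ext|exact: ep_uniqS ext|..].
Qed.
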